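(* Let $G$ be an Eulerian digraph of maximum degree $4$ and let $n=|V(G)|$. Then $G$ strongly immerses into every $6n$-router $\mathcal R_{6n}$.
   Context: Digraphs are finite and may have loops and parallel edges; Eulerian means in-degree equals out-degree at every vertex. A circle is a directed cycle without repeated vertices. A $k$-router $\mathcal R_k$ is an Eulerian digraph with vertex set $\{v_{i,j}: 1\le i<j\le k\}$ (one vertex per unordered pair) together with a family of pairwise edge-disjoint circles $C_1,\dots,C_k$ whose union is the whole digraph and such that $V(C_i)\cap V(C_j)=\{v_{i,j}\}$ for all $i<j$. A strong immersion of $H$ into $G$ maps vertices of $H$ injectively to vertices of $G$ and each edge $(u,v)$ of $H$ to a directed trail (sequence of distinct edges, head of each equal to tail of the next) of $G$ from the image of $u$ to the image of $v$, such that trails of distinct edges are edge-disjoint and no image of a vertex of $H$ is an internal vertex of any trail. *)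

(* Defs.v *)
From mathcomp Require Import all_boot.

Set Implicit Arguments.
Unset Strict Implicit.
Unset Printing Implicit Defensive.

(* An edge [e] is directed from [etail e] to [ehead e]; loops and parallel
   edges are allowed. *)
Record digraph := Digraph {
  vertex : finType;
  edge : finType;
  etail : edge -> vertex;
  ehead : edge -> vertex
}.

Section Digraphs.
Variable G : digraph.
Implicit Types (x y : vertex G) (e f : edge G) (p q : seq (edge G)).

Definition indegree x := #|[set e : edge G | ehead e == x]|.
Definition outdegree x := #|[set e : edge G | etail e == x]|.

(* A loop contributes 2. *)
Definition degree x := indegree x + outdegree x.
Definition max_degree := \max_(x : vertex G) degree x.

Definition eulerian := forall x, indegree x = outdegree x.

Definition follows : rel (edge G) := [rel e f | ehead e == etail f].

(* A circle is listed by its edges in cyclic order, from an arbitrary starting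
   edge; each of its vertices is the tail of exactly one of them.  A loop is a
   circle of length 1. *)
Definition is_circle p :=
  [&& p != [::], cycle follows p & uniq [seq etail e | e <- p]].

Definition circle_vertices p : {set vertex G} :=
  [set x in [seq etail e | e <- p]].

(* Trails have at least one edge, so a trail from [x] to [x] is a nontrivial
   closed trail. *)
Definition is_trail x y p :=
  if p is e :: q then
    [&& uniq p, etail e == x, path follows e q & ehead (last e q) == y]
  else false.

(* An end of a trail that is revisited in between is listed as internal. *)
Definition internal_vertices p := behead [seq etail e | e <- p].

Definition edge_disjoint p q := forall e, ~ (e \in p /\ e \in q).

End Digraphs.

(* Only the values [rvertex i j] with [i < j] are meaningful. *)
Record router (k : nat) := Router {
  router_digraph :> digraph;
  rvertex : 'I_k -> 'I_k -> vertex router_digraph;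
  rcircle : 'I_k -> seq (edge router_digraph);
  router_eulerian : eulerian router_digraph;
  rvertex_inj : forall i j i' j' : 'I_k, i < j -> i' < j' ->
    rvertex i j = rvertex i' j' -> i = i' /\ j = j';
  rvertex_surj : forall x, exists i j : 'I_k, i < j /\ x = rvertex i j;
  rcircleP : forall i, is_circle (rcircle i);
  rcircle_disjoint : forall i j,
    i != j -> edge_disjoint (rcircle i) (rcircle j);
  rcircle_cover_edges : forall e, exists i, e \in rcircle i;
  rcircle_cover_vertices : forall x, exists i, x \in circle_vertices (rcircle i);
  rcircle_meet : forall i j : 'I_k, i < j ->
    circle_vertices (rcircle i) :&: circle_vertices (rcircle j)
      = [set rvertex i j]
}.

Definition strongly_immerses (H G : digraph) :=
  exists (phi : vertex H -> vertex G) (tau : edge H -> seq (edge G)),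
    [/\ injective phi,
        forall e, is_trail (phi (etail e)) (phi (ehead e)) (tau e),
        forall e f, e != f -> edge_disjoint (tau e) (tau f)
      & forall e x, phi x \notin internal_vertices (tau e)].

(* Main.v *)
(** Each vertex [u] of [G] sits on two circles of its own, their common vertex
    being the image of [u]; each of these circles serves one edge leaving [u]
    and one edge entering [u], and owns two auxiliary circles.  Running along
    the circle from the image of [u], the auxiliary circle met first serves as
    exit and the other one as entry, so the arc up to the exit and the arc from
    the entry back to [u] are disjoint.  An edge is routed along the arc of its
    tail, then the exit circle, then the entry circle, then the arc of its head.
    This takes [2n + 4n] circles, and only the first [2n] carry images of
    vertices. *)

Require Import Defs.
From mathcomp Require Import all_boot.

Set Implicit Arguments.
Unset Strict Implicit.
Unset Printing Implicit Defensive.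

(** * Trails and arcs of circles *)

Section Trails.
Variable D : digraph.
Implicit Types (x y z : vertex D) (p q s t : seq (edge D)).

Lemma is_trail_cat x y z p q :
  is_trail x y p -> is_trail y z q -> edge_disjoint p q -> is_trail x z (p ++ q).
Proof.
case: p => // e p; case: q => // f q.
move=> /and4P[Up xe Pp /eqP ly] /and4P[Uq /eqP fy Pq lz] dis.
change [&& uniq ((e :: p) ++ f :: q), etail e == x,
  path (@follows D) e (p ++ f :: q) & ehead (last e (p ++ f :: q)) == z].
rewrite cat_uniq Up Uq xe cat_path Pp last_cat /= Pq /follows /= ly fy eqxx lz !andbT.
apply/(@hasPn _ _ (f :: q)) => g gq; apply/negP => gp.
exact: dis g (conj gp gq).
Qed.

Lemma edge_disjoint_cat p q s :
  edge_disjoint p q -> edge_disjoint p s -> edge_disjoint p (q ++ s).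
Proof.
move=> pq ps e [ep]; rewrite mem_cat => /orP[] eqs.
  exact: pq e (conj ep eqs).
exact: ps e (conj ep eqs).
Qed.

Lemma circle_verticesP p x :
  reflect (exists2 e, e \in p & x = etail e) (x \in circle_vertices p).
Proof. by rewrite inE; apply: mapP. Qed.

Lemma etail_circle x p q : {subset q <= p} ->
  x \in [seq etail e | e <- q] -> x \in circle_vertices p.
Proof. by move=> qp /mapP[e /qp ep ->]; apply/circle_verticesP; exists e. Qed.

Lemma circle_rot x p : is_circle p -> x \in circle_vertices p ->
  exists e q, [/\ x = etail e, is_circle (e :: q) & e :: q =i p].
Proof.
case/and3P=> _ cp up /circle_verticesP[e ep ->].
case: (rot_to ep) => i q def_q; exists e, q; split=> //.
  by rewrite /is_circle -def_q rot_cycle cp map_rot rot_uniq up def_q.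
by move=> f; rewrite -def_q mem_rot.
Qed.

Lemma circle_arcs e q f r : is_circle (e :: q ++ f :: r) ->
  is_trail (etail e) (etail f) (e :: q) /\ is_trail (etail f) (etail e) (f :: r).
Proof.
case/and3P=> _ cp /map_uniq; rewrite -cat_cons cat_uniq => /and3P[Uq _ Ur].
move: cp; rewrite /= rcons_cat cat_path /= rcons_path.
case/and4P=> Pq lq Pr lr; by split; apply/and4P; split; rewrite ?eqxx.
Qed.

Lemma circle_arc x y p : is_circle p -> x != y ->
    x \in circle_vertices p -> y \in circle_vertices p ->
  exists2 s, is_trail x y s & {subset s <= p}.
Proof.
move=> cp xy xp yp; have [e [q [def_x cq eq_qp]]] := circle_rot cp xp.
case/circle_verticesP: yp => f; rewrite -eq_qp inE => /predU1P[-> def_y|fq def_y].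
  by rewrite def_x def_y eqxx in xy.
case/splitPr: fq cq eq_qp => q1 q2 cq eq_qp.
have [Ts _] := circle_arcs cq.
exists (e :: q1); first by rewrite def_x def_y.
by move=> g gs; rewrite -eq_qp -cat_cons mem_cat gs.
Qed.

(** Run along the circle from [x]: the point met first becomes [y b], and the arc from it to the
    other point is dropped. The order of the points is dictated by the circle, so [b] is
    existential. The arc [t] is to end a longer trail, hence even its first tail has to avoid [x],
    whereas [s] starts at [x]. *)
Lemma circle_two_arcs x (y : bool -> vertex D) p :
    is_circle p -> x \in circle_vertices p ->
    (forall b, y b \in circle_vertices p) -> (forall b, x != y b) ->
    y true != y false ->
  exists (b : bool) s t,
    [/\ is_trail x (y b) s /\ is_trail (y (~~ b)) x t, edge_disjoint s t,
        x \notin internal_vertices s, x \notin [seq etail e | e <- t]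
      & {subset s <= p} /\ {subset t <= p}].
Proof.
move=> cp xp yp xy yTF; have [e [q [def_x cq eq_qp]]] := circle_rot cp xp.
have y_q b : exists2 f, f \in q & y b = etail f.
  case/circle_verticesP: (yp b) => f; rewrite -eq_qp inE.
  case/predU1P=> [-> def_y|fq def_y]; last by exists f.
  by move: (xy b); rewrite def_x def_y eqxx.
(* Both orders of the two points reduce to this: [y b] is the tail of the earlier edge [f], and
   [f :: q2] is the dropped middle arc. *)
have arcs b q1 f q2 g q3 : q = q1 ++ f :: q2 ++ g :: q3 ->
    y b = etail f -> y (~~ b) = etail g ->
  exists (b : bool) s t,
    [/\ is_trail x (y b) s /\ is_trail (y (~~ b)) x t, edge_disjoint s t,
        x \notin internal_vertices s, x \notin [seq etail e | e <- t]
      & {subset s <= p} /\ {subset t <= p}].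
  move=> def_q def_f def_g; exists b, (e :: q1), (g :: q3).
  have := cq; rewrite {1}def_q => /circle_arcs[Ts _].
  have := cq; rewrite {1}def_q -(cat_cons f) catA => /circle_arcs[_ Tt].
  case/and3P: (cq) => _ _; rewrite /= -def_x => /andP[x'q /map_uniq Uq].
  case/and3P: (cq) => _ _ /map_uniq; rewrite def_q.
  rewrite -cat_cons -cat_cons catA cat_uniq => /and3P[_ /hasPn dis _].
  split; first by rewrite def_f def_g def_x.
  - by move=> h [hs /dis]; rewrite mem_cat hs.
  - by apply: contra x'q; rewrite def_q map_cat mem_cat /internal_vertices /= => ->.
  - by apply: contra x'q; rewrite def_q -(cat_cons f) catA map_cat mem_cat orbC => ->.
  - split=> h hs; rewrite -eq_qp def_q; first by rewrite -cat_cons mem_cat hs.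
    by rewrite -(cat_cons f) catA -cat_cons mem_cat hs orbT.
have [f fq def_f] := y_q true; have [g gq def_g] := y_q false.
have gf : g != f by apply: contraNneq yTF => gf; rewrite def_f def_g gf.
case/splitPr: fq gq (arcs) => q1 q2 gq {}arcs.
move: gq; rewrite mem_cat inE (negPf gf) /= => /orP[] gq.
  case/splitPr: gq arcs => q3 q4 arcs.
  by apply: (arcs false q3 g q4 f q2) => //; rewrite -catA.
case/splitPr: gq arcs => q3 q4 arcs.
by apply: (arcs true q1 f q3 g q4).
Qed.

End Trails.

(** * Crossings of the circles of a router *)

Section Crossings.
Variables (k : nat) (R : router k).
Implicit Types i j l : 'I_k.

(** Symmetrised because [rvertex] is meaningful only for increasing indices. *)
Definition crossing i j : vertex R :=
  if i < j then rvertex R i j else rvertex R j i.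

Lemma crossingC i j : crossing i j = crossing j i.
Proof.
by rewrite /crossing; case: ltngtP => // /val_inj ->.
Qed.

Lemma circle_meet i j : i != j ->
  circle_vertices (rcircle R i) :&: circle_vertices (rcircle R j)
    = [set crossing i j].
Proof.
rewrite -val_eqE neq_ltn /crossing => /orP[] lt_ij; first by rewrite lt_ij rcircle_meet.
by rewrite ltnNge ltnW //= setIC rcircle_meet.
Qed.

Lemma crossing_in i j : i != j ->
  crossing i j \in circle_vertices (rcircle R i).
Proof.
move=> ij; have /setP/(_ (crossing i j)) := circle_meet ij.
by rewrite !inE eqxx => /andP[].
Qed.

Lemma crossing_inr i j : i != j ->
  crossing i j \in circle_vertices (rcircle R j).
Proof. by rewrite crossingC eq_sym; apply: crossing_in. Qed.

Lemma crossing_injr i j l : i != j -> i != l ->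
  crossing i j = crossing i l -> j = l.
Proof.
rewrite -!val_eqE !neq_ltn /crossing.
case: (ltngtP i j) => // ij _; case: (ltngtP i l) => // il _ /rvertex_inj[] //.
  by move=> eq_il; rewrite eq_il ltnn in il.
by move=> _ eq_il; rewrite eq_il ltnn in il.
Qed.

(** No vertex lies on three circles: for [l] other than [i], the vertex would be the single common
    vertex of circles [i] and [l], and crossings on circle [i] determine the other circle. *)
Lemma mem_crossing i j l : i != j ->
  crossing i j \in circle_vertices (rcircle R l) -> l = i \/ l = j.
Proof.
move=> ij cl; case: (eqVneq i l) => [|il]; [by left | right].
apply/esym/(crossing_injr ij il)/set1P.
by rewrite -circle_meet // inE crossing_in.
Qed.

Lemma mem_rcircle_inj i j e : e \in rcircle R i -> e \in rcircle R j -> i = j.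
Proof.
move=> ei ej; case: (eqVneq i j) => // /(@rcircle_disjoint _ R) dis.
by case: (dis e).
Qed.

End Crossings.

(** * Distributing the edges at a vertex over two slots *)

Lemma eulerian_degree (G : digraph) (d : nat) (x : vertex G) :
  eulerian G -> max_degree G <= d.*2 -> indegree x <= d /\ outdegree x <= d.
Proof.
move=> /(_ x) eG dG.
have : degree x <= d.*2 by apply: leq_trans dG; apply: leq_bigmax.
by rewrite /degree eG addnn leq_double.
Qed.

(** The Boolean tells whether an element comes first in the enumeration of its fibre; with at most
    two elements, this fixes its position. *)
Lemma split_fibers (T : finType) (V : eqType) (h : T -> V) :
    (forall x, #|[set e | h e == x]| <= 2) ->
  exists b : T -> bool, injective (fun e => (h e, b e)).
Proof.
move=> h2; exists (fun e => index e (enum [set f | h f == h e]) == 0).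
move=> e f [hef]; rewrite hef => eq0.
set L := enum _ in eq0; have eL : e \in L by rewrite mem_enum inE hef.
have fL : f \in L by rewrite mem_enum inE.
have L2 : size L <= 2 by rewrite -cardE.
apply: (index_inj e eL fL); move: eq0.
have := eL; have := fL; rewrite -!index_mem.
move=> /leq_trans/(_ L2) + /leq_trans/(_ L2).
by case: (index e L) => [|[|]] //; case: (index f L) => [|[|]].
Qed.

(** * Routing the edges through the router *)

Section Routing.
Variables (G : digraph) (k : nat) (R : router k).
(* Slot [(u, b)] is one of the two places for an edge leaving, and for one
   entering, [u].  Its circles [c (u, b, None)] and [c (u, b, Some _)] are the
   one through the image of [u] and the two auxiliary ones. *)
Notation slot := (vertex G * bool)%type.
Variable c : slot * option bool -> 'I_k.
Hypothesis c_inj : injective c.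
Variables oslot islot : edge G -> bool.
Hypothesis oslot_inj : injective (fun e => (etail e, oslot e)).
Hypothesis islot_inj : injective (fun e => (ehead e, islot e)).

Let phi u := crossing R (c (u, true, None)) (c (u, false, None)).

Let c_eq a b : (c a == c b) = (a == b).
Proof. exact: inj_eq. Qed.

Let c_sides u : c (u, true, None) != c (u, false, None).
Proof. by rewrite c_eq !xpair_eqE andbF. Qed.

Let phi_in u b : phi u \in circle_vertices (rcircle R (c (u, b, None))).
Proof.
by case: b; [apply: crossing_in | apply: crossing_inr]; apply: c_sides.
Qed.

Let mem_phi u a : phi u \in circle_vertices (rcircle R (c a)) ->
  a.1.1 = u /\ a.2 = None.
Proof.
by move=> /(mem_crossing (c_sides u))[] /c_inj->.
Qed.

Lemma strongly_immerses_router : strongly_immerses G R.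
Proof.
have phi_inj : injective phi.
  by move=> u v uv; have := phi_in u true; rewrite uv => /mem_phi[/= ->].
have slot_circle (s : slot) b : c (s, None) != c (s, Some b).
  by rewrite c_eq xpair_eqE andbF.
have arcs (s : slot) : exists (b : bool) S T,
    [/\ is_trail (phi s.1) (crossing R (c (s, None)) (c (s, Some b))) S /\
        is_trail (crossing R (c (s, None)) (c (s, Some (~~ b)))) (phi s.1) T,
        edge_disjoint S T,
        phi s.1 \notin internal_vertices S,
        phi s.1 \notin [seq etail e | e <- T]
      & {subset S <= rcircle R (c (s, None))} /\
        {subset T <= rcircle R (c (s, None))}].
  apply: (@circle_two_arcs _ _ (fun b => crossing R (c (s, None)) (c (s, Some b)))).
  - exact: rcircleP.
  - by case: s => u b; apply: phi_in.
  - by move=> b; apply: crossing_in.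
  (* The crossing lies on an auxiliary circle, and no image of a vertex does. *)
  - move=> b; have := crossing_inr R (slot_circle s b).
    by apply: contraTneq => <-; apply/negP => /mem_phi[].
  - by apply/eqP => /crossing_injr/c_inj-/(_ (slot_circle _ _) (slot_circle _ _)).
have [b /fin_all_exists[S /fin_all_exists[T arcsP]]] := fin_all_exists arcs.
pose src e := (etail e, oslot e); pose dst e := (ehead e, islot e).
pose exit e := c (src e, Some (b (src e))).
pose entry e := c (dst e, Some (~~ b (dst e))).
(* If the two slots coincide, as may happen for a loop, the circles still carry opposite
   Booleans. *)
have exit_entry e f : exit e != entry f.
  rewrite c_eq; apply/eqP => -[uv ]; rewrite /src /dst uv => -> /eqP.
  by case: (b _).
have exitP e : exists2 M,
    is_trail (crossing R (c (src e, None)) (exit e)) (crossing R (exit e) (entry e)) M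
    & {subset M <= rcircle R (exit e)}.
  apply: circle_arc; first exact: rcircleP.
  - rewrite crossingC; apply/eqP => /crossing_injr-/(_ _ (exit_entry _ _))/c_inj.
    by rewrite eq_sym slot_circle => /(_ isT).
  - exact: crossing_inr (slot_circle _ _).
  - exact: crossing_in (exit_entry _ _).
have entryP e : exists2 N,
    is_trail (crossing R (exit e) (entry e)) (crossing R (c (dst e, None)) (entry e)) N
    & {subset N <= rcircle R (entry e)}.
  apply: circle_arc; first exact: rcircleP.
  - rewrite crossingC [X in _ != X]crossingC; apply/eqP => /crossing_injr/c_inj.
    by rewrite !(eq_sym (entry e)) exit_entry slot_circle => /(_ isT isT).
  - exact: crossing_inr (exit_entry _ _).
  - exact: crossing_inr (slot_circle _ _).
have [M M_trail M_sub] := fin_all_exists2 exitP.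
have [N N_trail N_sub] := fin_all_exists2 entryP.
have S_sub s : {subset S s <= rcircle R (c (s, None))} by have [_ _ _ _ []] := arcsP s.
have T_sub s : {subset T s <= rcircle R (c (s, None))} by have [_ _ _ _ []] := arcsP s.
have disj i j p q : {subset p <= rcircle R i} -> {subset q <= rcircle R j} ->
    i != j -> edge_disjoint p q.
  move=> pi qj /eqP ij g [/pi gi /qj gj]; exact: ij (mem_rcircle_inj gi gj).
(* Within one slot the two arcs share a circle, and their disjointness comes from [circle_two_arcs];
   otherwise the circles differ. *)
have ST_disj s t : edge_disjoint (S s) (T t).
  have [<-|st] := eqVneq s t; first by have [] := arcsP s.
  by apply: disj (S_sub s) (T_sub t) _; rewrite c_eq xpair_eqE (negPf st).
pose tau e := S (src e) ++ M e ++ N e ++ T (dst e).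
(* The right by which [e] uses the edge [g] of circle [c a]. An auxiliary circle serves a single
   role, exit or entry; the circle through the image serves both, so there the arc containing [g]
   decides. *)
pose owns e g (a : slot * option bool) := if a.2 is Some b'
  then (if b' == b a.1 then src e else dst e) = a.1
  else src e = a.1 /\ g \in S a.1 \/ dst e = a.1 /\ g \in T a.1.
have tauP e g : g \in tau e -> exists2 a, g \in rcircle R (c a) & owns e g a.
  rewrite !mem_cat => /or4P[] ge.
  - by exists (src e, None); [apply: S_sub | left].
  - by exists (src e, Some (b (src e))); [apply: M_sub | rewrite /owns /= eqxx].
  - exists (dst e, Some (~~ b (dst e))); first exact: N_sub.
    by rewrite /owns /=; case: (b _).
  - by exists (dst e, None); [apply: T_sub | right].
exists phi, tau; split=> //.
- move=> e; have [[S_trail _] _ _ _ _] := arcsP (src e).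
  have [[_ T_trail] _ _ _ _] := arcsP (dst e).
  apply: is_trail_cat S_trail _ _; last first.
    apply: edge_disjoint_cat; first exact: disj (S_sub _) (M_sub _) (slot_circle _ _).
    apply: edge_disjoint_cat; last exact: ST_disj.
    by apply: disj (S_sub _) (N_sub _) _; rewrite c_eq xpair_eqE andbF.
  apply: is_trail_cat (M_trail e) _ _; last first.
    apply: edge_disjoint_cat; first exact: disj (M_sub _) (N_sub _) (exit_entry _ _).
    by apply: disj (M_sub _) (T_sub _) _; rewrite c_eq xpair_eqE andbF.
  apply: is_trail_cat (N_trail e) T_trail _.
  by apply: disj (N_sub _) (T_sub _) _; rewrite c_eq xpair_eqE andbF.
(* A common edge lies on one circle only, so both owners refer to the same [a]. Equal roles force
   [e = f] by injectivity of the slots; opposite roles put [g] on both arcs of one slot. *)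
- move=> e f /eqP ef g [/tauP[a ga Pe] /tauP[a' ga' Pf]]; case: ef.
  move: Pe Pf; rewrite -(c_inj (mem_rcircle_inj ga ga')) /owns.
  case: a.2 => [b'|]; first by case: ifP => _ <- /esym; [apply: oslot_inj | apply: islot_inj].
  case=> -[<- ge] [[/esym ef gf]|[/esym ef gf]].
  + exact: oslot_inj.
  + by case: (ST_disj _ _ g (conj ge gf)).
  + by case: (ST_disj _ _ g (conj gf ge)).
  + exact: islot_inj.
- move=> e u; have [[S_trail _] _ S_int _ _] := arcsP (src e).
  have [_ _ _ T_tails _] := arcsP (dst e).
  (* Only the very first tail of the route is exempt, so all tails of the last three pieces count as
     internal. *)
  have S_cons p : internal_vertices (S (src e) ++ p) =
      internal_vertices (S (src e)) ++ [seq etail g | g <- p].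
    by case: (S (src e)) S_trail => //= h q _; rewrite /internal_vertices /= map_cat.
  rewrite S_cons !map_cat !mem_cat; apply/negP => /or4P[] u_in.
  + have /mem_phi[/= u_e _] : phi u \in circle_vertices (rcircle R (c (src e, None))).
      by apply: etail_circle (S_sub _) (mem_behead u_in).
    by move: S_int; rewrite /= u_e u_in.
  + by have /mem_phi[] := etail_circle (M_sub e) u_in.
  + by have /mem_phi[] := etail_circle (N_sub e) u_in.
  + have /mem_phi[/= u_e _] := etail_circle (T_sub _) u_in.
    by move: T_tails; rewrite /= u_e u_in.
Qed.
End Routing.

Theorem theorem6p1 (G : digraph) (n : nat) (hG : eulerian G)
  (hdeg : max_degree G <= 4) (hn : n = #|vertex G|) (R : router (6 * n)) :
  strongly_immerses G R.
Proof.
have [b b_inj] := split_fibers (fun x => proj2 (eulerian_degree (d := 2) x hG hdeg)).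
have [b' b'_inj] := split_fibers (fun x => proj1 (eulerian_degree (d := 2) x hG hdeg)).
(* There are [2 * n] slots, with three circles each. *)
have card_circles : #|{: (vertex G * bool) * option bool}| = 6 * n.
  by rewrite !card_prod card_option card_bool -hn -mulnA mulnC.
apply: (@strongly_immerses_router _ _ R (cast_ord card_circles \o enum_rank) _ b b') => //.
by apply: inj_comp; [apply: cast_ord_inj | apply: enum_rank_inj].
Qed.
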